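(* Let $L$ be a lattice and let $d:L\to L$ be an operator on $L$. (1) $\mathrm{DO}(L)=\{d\in \mathrm{DW}_1(L) : d \text{ is decreasing}\}$. (2) If $d$ is increasing, then $d\in \mathrm{DW}_1(L)$ if and only if $d$ is a $\wedge$-homomorphism, i.e. $d(x\wedge y)=d(x)\wedge d(y)$ for all $x,y\in L$.
   Context: An operator on a lattice $L$ is just a map $d:L\to L$. A derivation (differential operator of weight $0$) is an operator $d$ with $d(x\wedge y)=(d(x)\wedge y)\vee(x\wedge d(y))$ for all $x,y\in L$; the set of these is $\mathrm{DO}(L)$. A difference operator (differential operator of weight $1$) is an operator $d$ with $d(x\wedge y)=(d(x)\wedge y)\vee(x\wedge d(y))\vee(d(x)\wedge d(y))$ for all $x,y\in L$; the set of these is $\mathrm{DW}_1(L)$. An operator $d$ is decreasing if $d(x)\le x$ for all $x\in L$, and increasing if $x\le d(x)$ for all $x\in L$. *)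

(* Defs.v *)
From mathcomp Require Import all_boot all_order.
From mathcomp Require Import classical_sets.

Set Implicit Arguments.
Unset Strict Implicit.
Unset Printing Implicit Defensive.

Local Open Scope order_scope.

Definition DO (disp : Order.disp_t) (L : latticeType disp) : set (L -> L) :=
  [set d : L -> L | forall x y : L,
     (d (x `&` y) = (d x `&` y) `|` (x `&` d y))%O]%classic.

Definition DW1 (disp : Order.disp_t) (L : latticeType disp) : set (L -> L) :=
  [set d : L -> L | forall x y : L,
     (d (x `&` y) = (d x `&` y) `|` (x `&` d y) `|` (d x `&` d y))%O]%classic.

Definition decreasing (disp : Order.disp_t) (L : latticeType disp)
  (d : L -> L) : Prop := forall x : L, d x <= x.

Definition increasing (disp : Order.disp_t) (L : latticeType disp)
  (d : L -> L) : Prop := forall x : L, x <= d x.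

Arguments DO {disp} L _.
Arguments DW1 {disp} L _.

(* Main.v *)
Require Import Defs.
From mathcomp Require Import all_boot all_order.
From mathcomp Require Import classical_sets.

(** The two Leibniz rules differ only by the joinand [d x `&` d y], and
    comparing [d] with the identity decides which joinands are redundant.  If
    [d] is decreasing, then [d x `&` d y <= d x `&` y], so the extra term is
    absorbed and weights 0 and 1 impose the same rule ([decreasing_DO_DW1]).
    If [d] is increasing, then both mixed terms lie below [d x `&` d y], so
    only that term survives and the weight-1 rule says that [d] preserves meets
    ([increasing_Leibniz1]).  It remains to see that the weight-0 rule forces
    [d] to be decreasing: at [y = x] it reads [d x = d x `&` x]
    ([DO_decreasing]). *)

Import Order.LTheory.

Local Open Scope order_scope.

Lemma DO_decreasing (disp : Order.disp_t) (L : latticeType disp) (d : L -> L) :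
  DO L d -> decreasing d.
Proof.
by move=> dD x; have := dD x x; rewrite meetxx (meetC x) joinxx => ->; exact: leIr.
Qed.

Lemma decreasing_DO_DW1 (disp : Order.disp_t) (L : latticeType disp)
    (d : L -> L) :
  decreasing d -> DO L d <-> DW1 L d.
Proof.
move=> dle.
have absorb x y : (d x `&` y) `|` (x `&` d y) `|` (d x `&` d y)
                  = (d x `&` y) `|` (x `&` d y).
  by apply: join_l; apply: le_trans (leUl _ _); rewrite leI2.
by split=> dD x y; have := dD x y; rewrite absorb.
Qed.

Lemma increasing_Leibniz1 (disp : Order.disp_t) (L : latticeType disp)
    (d : L -> L) :
  increasing d ->
  forall x y : L,
    (d x `&` y) `|` (x `&` d y) `|` (d x `&` d y) = d x `&` d y.
Proof. by move=> dge x y; apply: join_r; rewrite leUx !leI2. Qed.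

Theorem proposition2p7 (disp : Order.disp_t) (L : latticeType disp) :
  DO L = [set d : L -> L | DW1 L d /\ decreasing d]%classic
  /\ (forall d : L -> L, increasing d ->
        (DW1 L d <-> forall x y : L, d (x `&` y) = d x `&` d y)).
Proof.
split.
  apply/seteqP; split=> d.
    move=> dD; have dle := DO_decreasing _ _ _ dD.
    by split=> //; apply/(decreasing_DO_DW1 _ _ _ dle).
  by case=> dW dle; apply/(decreasing_DO_DW1 _ _ _ dle).
move=> d dge; have leibE := increasing_Leibniz1 _ _ _ dge.
by split=> dW x y; have := dW x y; rewrite leibE.
Qed.
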